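(* Let $n\ge 1$, $d\ge 1$, let $f_1,\dots,f_n:\mathbb{R}^d\to\mathbb{R}$, and put $F(\mathbf z)=\sum_{i=1}^n f_i(\mathbf z)$. Let $\{G(t)\}_{t\ge 0}$ be a sequence of directed graphs on the vertex set $\{1,\dots,n\}$. Suppose that: (a) The graph sequence $\{G(t)\}$ is uniformly strongly connected. (b) Each function $f_i$ is convex over $\mathbb{R}^d$ and the set $Z^*=\operatorname{Argmin}_{\mathbf z\in\mathbb{R}^d}F(\mathbf z)$ is nonempty. (c) The subgradients of each $f_i$ are uniformly bounded, i.e., there exists $L_i<\infty$ such that for all $\mathbf z\in\mathbb{R}^d$, $\|\mathbf g_i\|\le L_i$ for all subgradients $\mathbf g_i$ of $f_i$ at $\mathbf z$. Let $\{\mathbf z_i(t)\}_{t\ge1}$, $i=1,\dots,n$, be generated by the subgradient-push method (with arbitrary initial vectors $\mathbf x_i(0)\in\mathbb{R}^d$ and arbitrary choices of subgradients), where the stepsizes $\alpha(t)>0$, $t\ge 1$, satisfy $$\sum_{t=1}^\infty \alpha(t)=\infty,\qquad \sum_{t=1}^\infty\alpha^2(t)<\infty,\qquad \alpha(t)\le\alpha(s)\ \text{ for all } t>s\ge 1.$$ Then there is some $\mathbf z^*\in Z^*$ such that $$\lim_{t\to\infty}\mathbf z_i(t)=\mathbf z^*\qquad\text{for all } i=1,\dots,n.$$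
   Context: Graphs. $G(t)$, $t=0,1,2,\dots$, is a directed graph with vertex set $\{1,\dots,n\}$ and edge set $E(t)$; $(j,i)\in E(t)$ means that $j$ can send messages to $i$ at time $t$. The sequence $\{G(t)\}$ is uniformly strongly connected if there is an integer $B>0$ such that for every $k\ge 0$ the directed graph on $\{1,\dots,n\}$ with edge set $\bigcup_{t=kB}^{(k+1)B-1}E(t)$ is strongly connected. Neighborhoods include the node itself: $N_i^{\rm in}(t)=\{j\mid (j,i)\in E(t)\}\cup\{i\}$, $N_i^{\rm out}(t)=\{j\mid (i,j)\in E(t)\}\cup\{i\}$, and $d_i(t)=|N_i^{\rm out}(t)|$ is the out-degree. Subgradient-push method. Each node $i$ maintains $\mathbf x_i(t),\mathbf w_i(t),\mathbf z_i(t)\in\mathbb{R}^d$ and a scalar $y_i(t)$, with $\mathbf x_i(0)\in\mathbb{R}^d$ arbitrary and $y_i(0)=1$. For all $t\ge 0$ and all $i$: $$\mathbf w_i(t+1)=\sum_{j\in N_i^{\rm in}(t)}\frac{\mathbf x_j(t)}{d_j(t)},\quad y_i(t+1)=\sum_{j\in N_i^{\rm in}(t)}\frac{y_j(t)}{d_j(t)},\quad \mathbf z_i(t+1)=\frac{\mathbf w_i(t+1)}{y_i(t+1)},$$ $$\mathbf x_i(t+1)=\mathbf w_i(t+1)-\alpha(t+1)\,\mathbf g_i(t+1),$$ where $\mathbf g_i(t+1)$ is a subgradient of $f_i$ at $\mathbf z_i(t+1)$. The norm $\|\cdot\|$ is Euclidean. *)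

(* Defs.v *)
From HB Require Import structures.
From mathcomp Require Import all_boot all_order all_algebra.
From mathcomp Require Import all_classical all_reals all_analysis.
Set Implicit Arguments.
Unset Strict Implicit.
Unset Printing Implicit Defensive.
Import Order.TTheory GRing.Theory Num.Theory.
Import numFieldNormedType.Exports.
Local Open Scope classical_set_scope.
Local Open Scope ring_scope.

(* The library's norm on matrices is the max norm, hence the two definitions
   below; the topology of 'rV[R]_d is the usual one of R^d. *)
Definition dotv (R : realType) (d : nat) (u v : 'rV[R]_d) : R :=
  \sum_k u 0 k * v 0 k.

Definition norm2 (R : realType) (d : nat) (u : 'rV[R]_d) : R :=
  Num.sqrt (dotv u u).

Definition subgradient (R : realType) (d : nat) (h : 'rV[R]_d -> R)
    (z g : 'rV[R]_d) : Prop :=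
  forall u : 'rV[R]_d, h z + dotv g (u - z) <= h u.

Definition argmin (R : realType) (d : nat) (h : 'rV[R]_d -> R) : set 'rV[R]_d :=
  [set z | forall u, h z <= h u].

Section Digraphs.
Variable n : nat.
Implicit Types (e : rel 'I_n) (E : nat -> rel 'I_n) (i j : 'I_n).

Definition strongly_connected e : Prop := forall i j, connect e i j.

(* Union of the edge sets of E(t) for a <= t < b. *)
Definition union_graph E (a b : nat) : rel 'I_n :=
  fun i j => has (fun t => E t i j) (index_iota a b).

Definition uniformly_strongly_connected E : Prop :=
  exists2 B : nat, (0 < B)%N &
    forall k : nat, strongly_connected (union_graph E (k * B) (k.+1 * B)).

(* e j i means that j can send messages to i; neighborhoods contain the node
   itself, whether or not e has self-loops. *)
Definition in_nbrs e i : {set 'I_n} := i |: [set j | e j i]%SET.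
Definition out_nbrs e i : {set 'I_n} := i |: [set j | e i j]%SET.
Definition out_degree e i : nat := #|out_nbrs e i|.

End Digraphs.

(* All sequences are indexed by time first, then by node. The values w 0, z 0
   and g 0 play no role and are left unconstrained; so is x 0, which is the
   arbitrary initialization of the method. *)
Record subgradient_push (R : realType) (n d : nat)
    (f : 'I_n -> 'rV[R]_d -> R) (E : nat -> rel 'I_n) (alpha : nat -> R)
    (x w z g : nat -> 'I_n -> 'rV[R]_d) (y : nat -> 'I_n -> R) : Prop :=
  SubgradientPush {
    push_y0 : forall i, y 0%N i = 1;
    push_w : forall t i, w t.+1 i =
      \sum_(j in in_nbrs (E t) i) (out_degree (E t) j)%:R^-1 *: x t j;
    push_y : forall t i, y t.+1 i =
      \sum_(j in in_nbrs (E t) i) y t j / (out_degree (E t) j)%:R;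
    push_z : forall t i, z t.+1 i = (y t.+1 i)^-1 *: w t.+1 i;
    push_g : forall t i, subgradient (f i) (z t.+1 i) (g t.+1 i);
    push_x : forall t i, x t.+1 i = w t.+1 i - alpha t.+1 *: g t.+1 i
  }.

(* Main.v *)
Require Import Defs.
From HB Require Import structures.
From mathcomp Require Import all_boot all_order all_algebra.
From mathcomp Require Import all_classical all_reals all_analysis.
From mathcomp Require Import ring lra zify.
Set Implicit Arguments.
Unset Strict Implicit.
Unset Printing Implicit Defensive.
Import Order.TTheory GRing.Theory Num.Theory.
Import numFieldNormedType.Exports.
Local Open Scope classical_set_scope.
Local Open Scope ring_scope.

(** The method is a consensus iteration in disguise.  The pairs
    [(x t i, y t i)] are moved by the same column-stochastic weights, so the
    ratios [x t i / y t i] are averaged by a row-stochastic matrix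
    ([ratio_weight]) and perturbed by [alpha / y] times a bounded subgradient.

    Uniform strong connectivity makes every node reach every other one within
    a fixed number [T] of steps ([reach_full]).  This bounds [y] away from [0]
    ([push_sum_lower_bound]), hence the averaging matrices away from [0] on
    the edges, hence over [T] steps the spread of the ratios contracts by a
    factor smaller than one, up to a perturbation of order [alpha]
    ([spread_contraction]).  As [alpha] is nonincreasing and square summable,
    the spread is square summable too ([spread_sqr_bounded_sums]).

    Let [F] be the sum of the [f i] and [h t] the mean of the [x t i].  Both
    [h t] and the [z t.+1 i] are weighted averages of the ratios, so the squared distances between them are
    summable; and [h t.+1] is [h t] minus [alpha t.+1 / n] times the sum of the
    [g t.+1 i].  Expanding the square gives, for a minimizer [v] of [F],
      [|h t.+1 - v|^2 <= |h t - v|^2 - 2 alpha / n * (F (h t) - F v) + c t]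
    with [c] summable ([mean_descent]).  Since the sum of [alpha] diverges,
    [F (h t)] comes arbitrarily close to the minimum at arbitrarily late times;
    the bounded sequence [h] then clusters at a minimizer [p] along such
    times, and the same inequality with [v := p] forces [h], and with it every
    [z], to converge to [p] ([quasi_fejer_cvg]).

    The bound on the subgradients is given only where subgradients exist; the
    comparison of [f i] at [h t] and at [z t.+1 i], and the closedness of the
    set of minimizers, use that a convex function on the whole space has a
    subgradient at every point ([subgradient_exists]). *)

(** * Inner products and subgradients of convex functions *)

Section Dotv.
Variables (R : realType) (d : nat).
Implicit Types u v : 'rV[R]_d.

Lemma dotvC u v : dotv u v = dotv v u.
Proof. by apply: eq_bigr => k _; rewrite mulrC. Qed.

Lemma dotvDr u v1 v2 : dotv u (v1 + v2) = dotv u v1 + dotv u v2.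
Proof. by rewrite -big_split; apply: eq_bigr => k _; rewrite mxE mulrDr. Qed.

Lemma dotvZr c u v : dotv u (c *: v) = c * dotv u v.
Proof. by rewrite mulr_sumr; apply: eq_bigr => k _; rewrite mxE mulrCA. Qed.

Lemma dotvNr u v : dotv u (- v) = - dotv u v.
Proof. by rewrite -scaleN1r dotvZr mulN1r. Qed.

Lemma dotvBr u v1 v2 : dotv u (v1 - v2) = dotv u v1 - dotv u v2.
Proof. by rewrite dotvDr dotvNr. Qed.

Lemma dotvDl u1 u2 v : dotv (u1 + u2) v = dotv u1 v + dotv u2 v.
Proof. by rewrite dotvC dotvDr !(dotvC v). Qed.

Lemma dotvZl c u v : dotv (c *: u) v = c * dotv u v.
Proof. by rewrite dotvC dotvZr dotvC. Qed.

Lemma dotv_suml n (u : 'I_n -> 'rV[R]_d) v :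
  dotv (\sum_i u i) v = \sum_i dotv (u i) v.
Proof.
rewrite exchange_big; apply: eq_bigr => k _ /=.
by rewrite summxE mulr_suml.
Qed.

Lemma dotv_delta u k : dotv u (delta_mx 0 k) = u 0 k.
Proof.
rewrite /dotv (bigD1 k)//= big1 ?addr0; first by rewrite mxE !eqxx mulr1.
by move=> j jk; rewrite mxE eqxx (negPf jk) mulr0.
Qed.

Lemma dotv_ge0 u : 0 <= dotv u u.
Proof. by apply: sumr_ge0 => k _; rewrite -expr2 sqr_ge0. Qed.

Lemma sqr_entry_le_dotv u k : u 0 k ^+ 2 <= dotv u u.
Proof.
rewrite /dotv (bigD1 k)//= -expr2 lerDl sumr_ge0// => j _.
by rewrite -expr2 sqr_ge0.
Qed.

Lemma dotvBB u v : dotv (u - v) (u - v) = dotv u u - 2 * dotv u v + dotv v v.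
Proof. by rewrite dotvBr !(dotvC (u - v)) !dotvBr (dotvC v u); ring. Qed.

(** Expansion of the squared norm of [v - c *: u]; the scaling by [c] lets the
    step size be absorbed in squares, so that the Cauchy-Schwarz inequality is
    not used. *)
Lemma dotv_young c u v : 2 * c * dotv u v <= c ^+ 2 * dotv u u + dotv v v.
Proof.
have := dotv_ge0 (v - c *: u).
by rewrite dotvBB dotvZr dotvZl dotvZr (dotvC v u); lra.
Qed.

Lemma dotv_le_of_norm2 u L : norm2 u <= L -> dotv u u <= L ^+ 2.
Proof.
move=> uL; rewrite -(sqr_sqrtr (dotv_ge0 u)) -/(norm2 u).
by rewrite ler_sqr// ?nnegrE ?(le_trans _ uL) ?sqrtr_ge0.
Qed.

End Dotv.

Section Subgradients.
Variables (R : realType) (d : nat).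
Implicit Types (h : 'rV[R]_d -> R) (u v z g : 'rV[R]_d).

Lemma convex_functionP h : @convex_function R 'rV[R]_d [set: 'rV[R]_d] h ->
  forall (a b : R) u v, 0 <= a -> 0 <= b -> a + b = 1 ->
  h (a *: u + b *: v) <= a * h u + b * h v.
Proof.
move=> hc a b u v a0 b0 ab1.
have a1 : a <= 1 by rewrite -ab1 lerDl.
have bE : b = 1 - a by rewrite -ab1 addrC addKr.
have := hc (Itv01 a0 a1) u v.
rewrite !inE => /(_ I I).
by rewrite /conv/= /conv/= /= /unstable.onem -bE.
Qed.

(** [u] lies in the span of the first [k] basis vectors. *)
Definition low_support (k : nat) u := forall j : 'I_d, (k <= j)%N -> u 0 j = 0.

(** One-dimensional Hahn-Banach extension: convexity puts every slope imposed
    from the left of the new direction below every slope imposed from the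
    right, so a separating slope exists. *)
Lemma subgradient_extension h (k : 'I_d) g :
  (forall u v (a b : R), 0 <= a -> 0 <= b -> a + b = 1 ->
     h (a *: u + b *: v) <= a * h u + b * h v) ->
  (forall u, low_support k u -> dotv g u <= h u) ->
  exists g', forall u, low_support k.+1 u -> dotv g' u <= h u.
Proof.
move=> hc hg; pose e : 'rV[R]_d := delta_mx 0 k.
(* the slopes imposed on the direction [e] by the points on its left *)
pose A := [set c | exists (s : R) u, [/\ 0 < s, low_support k u &
  c = (dotv g u - h (u - s *: e)) / s]].
have sep (s1 : R) u1 (s2 : R) u2 : 0 < s1 -> low_support k u1 -> 0 < s2 ->
    low_support k u2 ->
    (dotv g u1 - h (u1 - s1 *: e)) / s1 <= (h (u2 + s2 *: e) - dotv g u2) / s2.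
  move=> s10 l1 s20 l2.
  have s0 : 0 < s1 + s2 by rewrite addr_gt0.
  have sN0 : s1 + s2 != 0 by rewrite gt_eqF.
  pose a := s2 / (s1 + s2); pose b := s1 / (s1 + s2).
  have a0 : 0 <= a by rewrite divr_ge0 ?ltW.
  have b0 : 0 <= b by rewrite divr_ge0 ?ltW.
  have ab1 : a + b = 1 by rewrite /a /b -mulrDl addrC mulfV.
  have := hc (u1 - s1 *: e) (u2 + s2 *: e) a b a0 b0 ab1.
  have -> : a *: (u1 - s1 *: e) + b *: (u2 + s2 *: e) = a *: u1 + b *: u2.
    apply/rowP => j; rewrite !mxE /a /b; field.
    exact: sN0.
  have := hg (a *: u1 + b *: u2).
  have lab : low_support k (a *: u1 + b *: u2).
    by move=> j kj; rewrite !mxE (l1 j kj) (l2 j kj) !mulr0 addr0.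
  move=> /(_ lab); rewrite dotvDr !dotvZr => H1 H2.
  have /(ler_wpM2r (ltW s0)) := le_trans H1 H2.
  have E p q : (a * p + b * q) * (s1 + s2) = s2 * p + s1 * q.
    by rewrite /a /b; field.
  rewrite !E => H.
  rewrite ler_pdivrMr// [leRHS]mulrAC ler_pdivlMr//; lra.
have A_ub (s2 : R) u2 : 0 < s2 -> low_support k u2 ->
    ubound A ((h (u2 + s2 *: e) - dotv g u2) / s2).
  by move=> s20 l2 _ [s1 [u1 [s10 l1 ->]]]; exact: sep.
have l0 : low_support k 0 by move=> j _; rewrite mxE.
have A0 : A !=set0 by eexists; exists 1, 0; split => //; exact: ltr01.
have Asup : has_sup A by split=> //; eexists; exact: (A_ub 1 0).
pose c := sup A.
(* the coefficient of [g] along [e] is replaced by [c] *)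
exists (g + (c - g 0 k) *: e) => u lu.
pose u' := u - u 0 k *: e.
have lu' : low_support k u'.
  move=> j; rewrite leq_eqVlt => /orP[/eqP kj|kj].
    have -> : j = k by apply/val_inj.
    by rewrite !mxE !eqxx mulr1 subrr.
  have /negPf jk : j != k by rewrite -val_eqE/= gtn_eqF.
  by rewrite !mxE (lu j kj) jk andbF mulr0 subrr.
have uE : u = u' + u 0 k *: e by rewrite subrK.
have -> : dotv (g + (c - g 0 k) *: e) u = dotv g u' + c * u 0 k.
  rewrite dotvDl dotvZl (dotvC e) dotv_delta /u' dotvBr dotvZr dotv_delta.
  by rewrite mulrBl; ring.
have [s0|s0|s0] := ltgtP (u 0 k) 0.
- have s0' : 0 < - u 0 k by rewrite oppr_gt0.
  have : (dotv g u' - h (u' - (- u 0 k) *: e)) / (- u 0 k) <= c.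
    by apply: sup_upper_bound => //; exists (- u 0 k), u'; split.
  rewrite scaleNr opprK -uE ler_pdivrMr//; lra.
- have : c <= (h (u' + u 0 k *: e) - dotv g u') / u 0 k.
    by apply: ge_sup => //; exact: A_ub.
  rewrite -uE ler_pdivlMr//; lra.
- by rewrite s0 mulr0 addr0 {1}uE s0 scale0r addr0; exact: hg.
Qed.

(** The graph of [h] around [z] is supported one coordinate at a time, starting
    from the trivial subspace. *)
Lemma subgradient_exists h z :
  @convex_function R 'rV[R]_d [set: 'rV[R]_d] h -> exists g, subgradient h z g.
Proof.
move=> /convex_functionP hc; pose h0 u := h (z + u) - h z.
have h0c u v (a b : R) : 0 <= a -> 0 <= b -> a + b = 1 ->
    h0 (a *: u + b *: v) <= a * h0 u + b * h0 v.
  move=> a0 b0 ab1; have := hc a b (z + u) (z + v) a0 b0 ab1.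
  have -> : a *: (z + u) + b *: (z + v) = z + (a *: u + b *: v).
    by rewrite !scalerDr addrACA -scalerDl ab1 scale1r.
  rewrite /h0 => H.
  rewrite (_ : _ + _ = a * h (z + u) + b * h (z + v) - (a + b) * h z); last ring.
  by rewrite ab1 mul1r lerD2r.
have H k : (k <= d)%N -> exists g, forall u, low_support k u -> dotv g u <= h0 u.
  elim: k => [_|k IH kd].
    exists 0 => u u0; have -> : u = 0 by apply/rowP => j; rewrite u0// mxE.
    by rewrite -(scale0r (0 : 'rV[R]_d)) dotvZr mul0r scale0r /h0 addr0 subrr.
  have [g hg] := IH (ltnW kd).
  exact: (@subgradient_extension h0 (Ordinal kd) g h0c hg).
have [g hg] := H d (leqnn d).
exists g => u; have := hg (u - z).
rewrite /h0 (addrC z) subrK lerBrDl; apply=> j.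
by rewrite leqNgt ltn_ord.
Qed.

End Subgradients.

(** * Reachability in time-varying graphs *)

Section Reach.
Variables (n : nat) (E : nat -> rel 'I_n).
Implicit Types (i j l : 'I_n) (t m : nat).

(** [l] passes mass on to [i] at time [t]; every node keeps a share. *)
Definition link t : rel 'I_n := fun l i => (l == i) || E t l i.

(** The nodes that a message sent by [j] at time [t] can have reached after
    [m] steps, waiting at a node being allowed. *)
Fixpoint reach t j m : {set 'I_n} :=
  if m is m'.+1 then [set i | [exists l in reach t j m', link (t + m') l i]]%SET
  else [set j]%SET.

Lemma in_nbrsE t i l : (l \in in_nbrs (E t) i) = link t l i.
Proof. by rewrite !inE. Qed.

Lemma out_nbrsE t i l : (i \in out_nbrs (E t) l) = link t l i.
Proof. by rewrite !inE eq_sym. Qed.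

Lemma reachS t j m l i :
  l \in reach t j m -> link (t + m) l i -> i \in reach t j m.+1.
Proof. by move=> lr li; rewrite inE; apply/existsP; exists l; rewrite lr. Qed.

Lemma reach_subset t j m m' : (m <= m')%N -> reach t j m \subset reach t j m'.
Proof.
move=> /subnK <-; elim: (m' - m)%N => [|k IH]; first by rewrite add0n.
apply: (fintype.subset_trans IH); apply/fintype.subsetP => i ir.
by rewrite addSn; apply: reachS ir _; rewrite /link eqxx.
Qed.

Lemma strongly_connected_edge_out (e : rel 'I_n) (A : {set 'I_n}) j :
  strongly_connected e -> j \in A -> A != [set: 'I_n]%SET ->
  exists l i, [/\ l \in A, i \notin A & e l i].
Proof.
move=> esc jA AT.
have [i iA] : exists i, i \notin A.
  by apply/existsP; rewrite -negb_forall; apply: contra AT => /forallP AT;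
    apply/eqP/setP => i; rewrite AT inE.
have /connectP[p] := esc j i.
elim: p j jA => [|k p IH] j jA /=; first by move=> _ ij; rewrite ij jA in iA.
move=> /andP[jk kp] ip; have [kA|kA] := boolP (k \in A); first exact: IH kp ip.
by exists j, k.
Qed.

Lemma reach_window (B k t : nat) j :
  strongly_connected (union_graph E (k * B) (k.+1 * B)) -> (t <= k * B)%N ->
  reach t j (k * B - t) != [set: 'I_n]%SET ->
  reach t j (k * B - t) \proper reach t j (k.+1 * B - t).
Proof.
move=> sc tk AT.
have jA : j \in reach t j (k * B - t).
  by apply: (fintype.subsetP (@reach_subset t j 0 _ (leq0n _))); rewrite inE.
have [l [i [lA iA]]] := strongly_connected_edge_out sc jA AT.
move=> /hasP[s]; rewrite mem_index_iota => /andP[ks sk] sli.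
rewrite properE reach_subset ?leq_sub2r ?leq_mul2r ?leqnSn ?orbT//=.
apply/fintype.subsetPn; exists i => //.
have lS : l \in reach t j (s - t).
  by apply: (fintype.subsetP (reach_subset _ _ _)) lA; rewrite leq_sub2r.
apply: (fintype.subsetP (@reach_subset t j (s - t).+1 _ _)).
  by rewrite ltn_sub2r// (leq_ltn_trans tk)// (leq_ltn_trans ks).
apply: reachS lS _; rewrite subnKC ?(leq_trans tk)//.
by rewrite /link sli orbT.
Qed.

(** The reached set grows strictly over each window of length [B], so [n]
    windows suffice; one more absorbs a start [t] that is not a multiple
    of [B]. *)
Lemma reach_full (B t : nat) j : (0 < B)%N ->
  (forall k, strongly_connected (union_graph E (k * B) (k.+1 * B))) ->
  reach t j (n.+1 * B) = [set: 'I_n]%SET.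
Proof.
move=> B0 sc; pose k0 := (t %/ B).+1.
have tk0 : (t <= k0 * B)%N by rewrite ltnW// ltn_ceil.
have k0t : (k0 * B <= t + B)%N by rewrite mulSn addnC leq_add2r leq_divM.
have H m : (minn m.+1 n <= #|reach t j ((k0 + m) * B - t)|)%N.
  elim: m => [|m IH].
    rewrite geq_min; apply/orP; left; rewrite card_gt0; apply/set0Pn; exists j.
    by apply: (fintype.subsetP (@reach_subset t j 0 _ (leq0n _))); rewrite inE.
  have [E0|N0] := eqVneq (reach t j ((k0 + m) * B - t)) [set: 'I_n]%SET.
    rewrite geq_min; apply/orP; right.
    rewrite -[X in (X <= _)%N]card_ord -cardsT -E0 subset_leq_card//.
    by rewrite reach_subset// leq_sub2r// leq_mul2r addnS leqnSn orbT.
  have tkm : (t <= (k0 + m) * B)%N by rewrite (leq_trans tk0)// leq_mul2r leq_addr orbT.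
  have := proper_card (reach_window (sc _) tkm N0);
    rewrite addnS => H1.
  by have := leq_ltn_trans IH H1; lia.
have := H n; rewrite (minn_idPr (leqnSn n)) => Hn.
apply/eqP; rewrite -finset.subTset.
have -> : [set: 'I_n]%SET = reach t j ((k0 + n) * B - t).
  by apply/esym/eqP; rewrite eqEcard finset.subsetT cardsT card_ord.
apply: reach_subset; rewrite leq_subLR mulnDl mulSn addnA.
by rewrite leq_add2r.
Qed.

(** A family of real sequences losing at most a factor [b] along each link
    retains the fraction [b ^+ m] of its value at [j] over [m] steps. *)
Lemma reach_lower_bound (R : realType) (b : R) (v : nat -> 'I_n -> R) t j :
  0 <= b ->
  (forall s l i, (t <= s)%N -> link s l i -> b * v s l <= v s.+1 i) ->
  forall m i, i \in reach t j m -> b ^+ m * v t j <= v (t + m)%N i.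
Proof.
move=> b0 bv; elim=> [|m IH] i.
  by rewrite inE => /eqP ->; rewrite expr0 mul1r addn0.
rewrite inE => /existsP[l /andP[lr li]].
rewrite exprS -mulrA addnS (le_trans _ (bv _ _ _ (leq_addr _ _) li))//.
by rewrite ler_wpM2l// IH.
Qed.

End Reach.

(** * Perturbed averaging *)

Section BoundedSums.
Variable R : realType.
Implicit Types u v : nat -> R.

(** For nonnegative [u] this is summability. *)
Definition bounded_sums u := exists K, forall N, \sum_(t < N) u t <= K.

Lemma bounded_sumsD u v :
  bounded_sums u -> bounded_sums v -> bounded_sums (fun t => u t + v t).
Proof.
move=> [K uK] [K' vK']; exists (K + K') => N.
by rewrite big_split lerD.
Qed.

Lemma bounded_sumsZ c u : 0 <= c -> bounded_sums u ->
  bounded_sums (fun t => c * u t).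
Proof.
move=> c0 [K uK]; exists (c * K) => N.
by rewrite -mulr_sumr ler_wpM2l.
Qed.

Lemma bounded_sums_sum d (u : 'I_d -> nat -> R) :
  (forall k, bounded_sums (u k)) -> bounded_sums (fun t => \sum_k u k t).
Proof.
move=> /choice[K uK]; exists (\sum_k K k) => N.
by rewrite exchange_big; apply: ler_sum => k _; exact: uK.
Qed.

(** Contraction by [q] over [T] steps up to a summable error: summing the
    recursion over [t < N] bounds [(1 - q)] times the partial sums. *)
Lemma bounded_sums_recursion (T : nat) (q : R) u v :
  q < 1 -> (forall t, 0 <= u t) ->
  (forall t, u (t + T)%N <= q * u t + v t) ->
  bounded_sums v -> bounded_sums u.
Proof.
move=> q1 u0 uv [K vK].
have p0 : 0 < 1 - q by rewrite subr_gt0.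
exists ((\sum_(t < T) u t + K) / (1 - q)) => N.
rewrite ler_pdivlMr// mulrBr mulr1 lerBlDr.
have H1 : \sum_(t < N) u t <= \sum_(t < T + N) u t.
  by rewrite addnC big_split_ord lerDl sumr_ge0.
apply: (le_trans H1); rewrite big_split_ord /= -addrA lerD2l.
apply: (@le_trans _ _ (\sum_(t < N) (q * u t + v t))).
  by apply: ler_sum => i _; rewrite addnC.
rewrite big_split -mulr_sumr /= mulrC addrC lerD2r.
exact: vK.
Qed.

(** A nonnegative sequence with bounded sums has arbitrarily small tails. *)
Lemma bounded_sums_tail u e : (forall t, 0 <= u t) -> bounded_sums u ->
  0 < e -> exists N, forall s t, (N <= s)%N -> \sum_(s <= r < t) u r < e.
Proof.
move=> u0 [K uK] e0; pose A := range (fun N => \sum_(t < N) u t).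
have Asup : has_sup A.
  split; first by exists (\sum_(t < 0) u t), 0%N.
  by exists K => _ [N _ <-].
have [_ [N _ <-]] := sup_adherent e0 Asup.
rewrite ltrBlDr => HN.
exists N => s t Ns; have [ts|st] := leqP t s; first by rewrite big_geq.
have : \sum_(r < t) u r <= sup A by apply: sup_upper_bound => //; exists t.
rewrite -(big_mkord xpredT u) in HN; rewrite -(big_mkord xpredT u).
rewrite (big_cat_nat (leq0n s) (ltnW st)) (big_cat_nat (leq0n N) Ns) /=.
have : 0 <= \sum_(N <= r < s) u r by rewrite sumr_ge0.
lra.
Qed.

End BoundedSums.

(** Convexity of the square at [q * D + (1 - q) * (x / (1 - q))]. *)
Lemma sqr_convex_combination (R : realType) (q D x : R) : 0 <= q -> q < 1 ->
  (q * D + x) ^+ 2 <= q * D ^+ 2 + x ^+ 2 / (1 - q).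
Proof.
move=> q0 q1; have p0 : 0 < 1 - q by rewrite subr_gt0.
have pN0 : 1 - q != 0 by rewrite gt_eqF.
rewrite -subr_ge0.
have -> : q * D ^+ 2 + x ^+ 2 / (1 - q) - (q * D + x) ^+ 2 =
    q / (1 - q) * ((1 - q) * D - x) ^+ 2 by field.
by rewrite mulr_ge0 ?sqr_ge0// divr_ge0// ltW.
Qed.

Section Averaging.
Variables (R : realType) (n : nat).
Implicit Types (a : 'I_n -> R) (i j : 'I_n).

(** The diameter of the set of values of [a]. *)
Definition spread a : R := \big[Num.max/0]_(p : 'I_n * 'I_n) (a p.1 - a p.2).

Lemma le_spread a i j : a i - a j <= spread a.
Proof. exact: (le_bigmax 0 (fun p : 'I_n * 'I_n => a p.1 - a p.2) (i, j)). Qed.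

Lemma spread_ge0 a : 0 <= spread a.
Proof. exact: bigmax_ge_id. Qed.

Lemma spread_le a D : 0 <= D -> (forall i j, a i - a j <= D) -> spread a <= D.
Proof. by move=> D0 aD; apply: bigmax_le => // -[i j]. Qed.

Lemma spread_attained a : (0 < n)%N -> exists i0 i1,
  [/\ forall i, a i0 <= a i, forall i, a i <= a i1 & spread a = a i1 - a i0].
Proof.
move=> n0; pose o : 'I_n := Ordinal n0.
have [i0 _ m0] := arg_minP a (erefl : xpredT o).
have [i1 _ m1] := arg_maxP a (erefl : xpredT o).
exists i0, i1; split=> [i|i|]; [exact: m0|exact: m1|].
apply/eqP; rewrite eq_le le_spread andbT; apply: spread_le => [|i j].
  by rewrite subr_ge0; exact: m0.
by rewrite lerB//; [exact: m1|exact: m0].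
Qed.

Lemma dist_averages_le_spread a (p q : 'I_n -> R) :
  (forall i, 0 <= p i) -> \sum_i p i = 1 ->
  (forall i, 0 <= q i) -> \sum_i q i = 1 ->
  \sum_i p i * a i - \sum_i q i * a i <= spread a.
Proof.
move=> p0 p1 q0 q1.
have -> : \sum_i p i * a i - \sum_i q i * a i =
    \sum_i \sum_j p i * q j * (a i - a j).
  have -> : \sum_i p i * a i = \sum_i \sum_j p i * q j * a i.
    apply: eq_bigr => i _; rewrite -[LHS]mulr1 -q1 mulr_sumr.
    by apply: eq_bigr => j _; rewrite mulrAC.
  have -> : \sum_i q i * a i = \sum_i \sum_j p i * q j * a j.
    rewrite exchange_big; apply: eq_bigr => j _ /=.
    rewrite -[LHS]mul1r -p1 mulr_suml.
    by apply: eq_bigr => i _; rewrite mulrA.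
  rewrite -sumrB; apply: eq_bigr => i _; rewrite -sumrB.
  by apply: eq_bigr => j _; rewrite mulrBr.
apply: (@le_trans _ _ (\sum_i \sum_j p i * q j * spread a)).
  by do 2![apply: ler_sum => ? _]; rewrite ler_wpM2l ?mulr_ge0 ?le_spread.
under eq_bigr => i _ do rewrite -mulr_suml -mulr_sumr q1 mulr1.
by rewrite -mulr_suml p1 mul1r.
Qed.

Variables (E : nat -> rel 'I_n) (P : nat -> 'I_n -> 'I_n -> R) (b : R).
Hypotheses (n_gt0 : (0 < n)%N) (b_gt0 : 0 < b) (b_le1 : b <= 1).
Hypothesis P_ge0 : forall t i j, 0 <= P t i j.
Hypothesis P_sum1 : forall t i, \sum_j P t i j = 1.
Hypothesis P_link : forall t i j, link E t j i -> b <= P t i j.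

(** Under averaging with errors [e], a lower bound [lo] deteriorates only by
    the accumulated errors, and improves at the nodes reached from [j] by a
    fraction of [a t j - lo]. *)
Lemma averaging_lower_bound (a : nat -> 'I_n -> R) (e : nat -> R) lo t j :
  (forall s i, \sum_l P s i l * a s l - e s <= a s.+1 i) ->
  (forall i, lo <= a t i) ->
  forall m, (forall i, lo - \sum_(t <= s < t + m) e s <= a (t + m)%N i) /\
  forall i, i \in reach E t j m ->
  lo + b ^+ m * (a t j - lo) - \sum_(t <= s < t + m) e s <= a (t + m)%N i.
Proof.
move=> aP loa.
(* adding the accumulated errors back makes [v] nonnegative and at least the
   average of its previous values *)
pose v s i := a s i - lo + \sum_(t <= r < s) e r.
have vP s i : (t <= s)%N -> \sum_l P s i l * v s l <= v s.+1 i.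
  move=> ts; have := aP s i; rewrite /v big_nat_recr//=.
  have -> : \sum_l P s i l * (a s l - lo + \sum_(t <= r < s) e r) =
     \sum_l P s i l * a s l + (- lo + \sum_(t <= r < s) e r).
    rewrite -[X in _ = _ + X]mul1r -(P_sum1 s i) mulr_suml -big_split.
    by apply: eq_bigr => l _ /=; rewrite -mulrDr addrA.
  lra.
have v0 m i : 0 <= v (t + m)%N i.
  elim: m i => [|m IH] i.
    by rewrite addn0 /v big_geq// addr0 subr_ge0.
  rewrite addnS (le_trans _ (vP _ _ (leq_addr _ _)))// sumr_ge0// => l _.
  by rewrite mulr_ge0.
have vb s l i : (t <= s)%N -> link E s l i -> b * v s l <= v s.+1 i.
  move=> ts li; apply: le_trans (vP s i ts).
  have v0' k : 0 <= v s k by rewrite -(subnKC ts).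
  rewrite (bigD1 l)//= -[leLHS]addr0 lerD ?sumr_ge0//.
    by rewrite ler_wpM2r// P_link.
  by move=> k _; rewrite mulr_ge0.
move=> m; split=> i; first by have := v0 m i; rewrite /v; lra.
move=> /(reach_lower_bound (ltW b_gt0) vb).
rewrite /v [in X in X -> _]big_geq//; lra.
Qed.

Lemma spread_contraction (a : nat -> 'I_n -> R) (e : nat -> R) t m :
  (forall s, 0 <= e s) ->
  (forall s i, `|a s.+1 i - \sum_l P s i l * a s l| <= e s) ->
  (forall j, reach E t j m = [set: 'I_n]%SET) ->
  spread (a (t + m)%N) <=
    (1 - b ^+ m) * spread (a t) + 2 * \sum_(t <= s < t + m) e s.
Proof.
move=> e0 ae full.
have [i0 [i1 [m0 m1 ->]]] := spread_attained (a t) n_gt0.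
set S := \sum_(t <= s < t + m) e s.
have S0 : 0 <= S by rewrite sumr_ge0.
have bm1 : b ^+ m <= 1 by rewrite exprn_ile1// ltW.
have low s i : \sum_l P s i l * a s l - e s <= a s.+1 i.
  by have := ae s i; rewrite ler_norml => /andP[+ _]; lra.
have upp s i : \sum_l P s i l * (- a s l) - e s <= - a s.+1 i.
  under eq_bigr => l _ do rewrite mulrN.
  by rewrite sumrN; have := ae s i; rewrite ler_norml => /andP[_]; lra.
(* the minimum is pulled up by the value at the maximizer [i1], while the
   maximum can grow only by the accumulated errors *)
have [_ L] := averaging_lower_bound i1 low m0 m.
have m1' i : - a t i1 <= - a t i by rewrite lerN2.
have [U _] := @averaging_lower_bound (fun s i => - a s i) e _ t i1 upp m1' m.
apply: spread_le => [|i j].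
  by rewrite addr_ge0 ?mulr_ge0 ?subr_ge0.
have := U i; have := L j; rewrite full inE => /(_ isT); rewrite -/S.
lra.
Qed.

(** Geometric contraction of the spread over windows of length [T], driven by
    perturbations of size [c * al]; squaring the recursion keeps it
    summable. *)
Lemma spread_sqr_bounded_sums (a : nat -> 'I_n -> R) (al : nat -> R) c T :
  0 <= c -> (forall s, 0 <= al s) ->
  (forall s r, (s <= r)%N -> al r <= al s) ->
  bounded_sums (fun s => al s ^+ 2) ->
  (forall s i, `|a s.+1 i - \sum_l P s i l * a s l| <= c * al s) ->
  (forall t j, reach E t j T = [set: 'I_n]%SET) ->
  bounded_sums (fun t => spread (a t) ^+ 2).
Proof.
move=> c0 al0 al_dec al_sum ae full.
set q := 1 - b ^+ T.
have p0 : 0 < 1 - q by rewrite /q opprB addrC subrK exprn_gt0.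
have q0 : 0 <= q by rewrite subr_ge0 exprn_ile1// ltW.
have q1 : q < 1 by rewrite -subr_gt0.
pose C := 2 * (T%:R * c).
have C0 : 0 <= C by rewrite !mulr_ge0.
have rec t : spread (a (t + T)%N) <= q * spread (a t) + C * al t.
  have ce0 s : 0 <= c * al s by rewrite mulr_ge0.
  apply: (le_trans (spread_contraction ce0 ae (full t))).
  rewrite lerD2l /C -mulrA ler_wpM2l//.
  apply: (@le_trans _ _ (\sum_(t <= s < t + T) c * al t)).
    rewrite big_nat_cond [leRHS]big_nat_cond; apply: ler_sum => s.
    by rewrite andbT => /andP[ts _]; rewrite ler_wpM2l// al_dec.
  by rewrite sumr_const_nat addKn -mulrA mulr_natl.
apply: (@bounded_sums_recursion _ T q _
   (fun t => (C ^+ 2 / (1 - q)) * al t ^+ 2)) => //.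
- by move=> t; rewrite sqr_ge0.
- move=> t; have := rec t.
  set D := spread (a t); set x := C * al t => Dx.
  have D0 : 0 <= D by exact: spread_ge0.
  have x0 : 0 <= x by rewrite mulr_ge0.
  apply: (@le_trans _ _ ((q * D + x) ^+ 2)).
    by rewrite ler_sqr ?nnegrE ?spread_ge0// addr_ge0// mulr_ge0.
  have -> : C ^+ 2 / (1 - q) * al t ^+ 2 = x ^+ 2 / (1 - q).
    by rewrite mulrAC -exprMn.
  exact: sqr_convex_combination.
- by apply: bounded_sumsZ => //; rewrite divr_ge0 ?sqr_ge0// ltW.
Qed.

End Averaging.

(** * Convergence of quasi-Fejer sequences *)

Lemma mx_ballE (R : realType) (d : nat) (p q : 'rV[R]_d) (e : R) : 0 < e ->
  ball p e q <-> forall k, `|p 0 k - q 0 k| < e.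
Proof.
move=> e0; split=> [[_ pq] k|pq]; first exact: pq.
by split=> // i k; rewrite (ord1 i); exact: pq.
Qed.

Section Fejer.
Variables (R : realType) (d : nat).
Implicit Types u v : 'rV[R]_d.
Variables (F : 'rV[R]_d -> R) (h : nat -> 'rV[R]_d) (al c : nat -> R).
Hypothesis F_subgrad : forall u, exists g, subgradient F u g.
Hypothesis F_argmin : argmin F !=set0.
Hypothesis al_ge0 : forall t, 0 <= al t.
Hypothesis al_sum : ~ bounded_sums al.
Hypothesis c_ge0 : forall t, 0 <= c t.
Hypothesis c_sum : bounded_sums c.

Let r v t := dotv (h t - v) (h t - v).

(* [h] is quasi-Fejer monotone with respect to the minimizers of [F] *)
Hypothesis descent : forall v t, argmin F v ->
  r v t.+1 <= r v t - al t * (F (h t) - F v) + c t.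

Let r_le v s t : argmin F v -> (s <= t)%N ->
  r v t <= r v s + \sum_(s <= k < t) c k.
Proof.
move=> vmin /subnKC <-; elim: (t - s)%N => [|m IH].
  by rewrite addn0 big_geq// addr0.
rewrite addnS big_nat_recr ?leq_addr//= addrA.
apply: (le_trans (descent _ vmin)); rewrite lerD2r.
apply: le_trans IH; rewrite gerBl mulr_ge0// subr_ge0; exact: vmin.
Qed.

(* Otherwise the descent inequality, summed over late times, would bound the
   sums of [al]. *)
Let frequently_near_min v e N : argmin F v -> 0 < e ->
  exists2 t, (N <= t)%N & F (h t) - F v < e.
Proof.
move=> vmin e0; apply: contrapT => H.
have far t : (N <= t)%N -> e <= F (h t) - F v.
  by move=> Nt; rewrite leNgt; apply/negP => He; apply: H; exists t.
have rm m : r v (N + m)%N <= r v N + \sum_(N <= k < N + m) c k -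
    e * \sum_(N <= k < N + m) al k.
  elim: m => [|m IH]; first by rewrite addn0 !big_geq// mulr0 subr0 addr0.
  rewrite addnS !big_nat_recr ?leq_addr//=.
  apply: (le_trans (descent _ vmin)).
  have := ler_wpM2l (al_ge0 (N + m)) (far _ (leq_addr m N)).
  rewrite mulrDr; lra.
have [K cK] := c_sum.
apply: al_sum; exists (\sum_(0 <= k < N) al k + (r v N + K) / e) => M.
have le1 : \sum_(k < M) al k <= \sum_(0 <= k < N + M) al k.
  rewrite -(big_mkord xpredT al) addnC (big_cat_nat (leq0n M) (leq_addr N M)) /=.
  by rewrite lerDl sumr_ge0.
apply: (le_trans le1).
rewrite (big_cat_nat (leq0n N) (leq_addr M N)) /= lerD2l ler_pdivlMr// mulrC.
have := rm M; have : 0 <= r v (N + M) by exact: dotv_ge0.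
have := cK (N + M)%N; rewrite -(big_mkord xpredT c).
rewrite (big_cat_nat (leq0n N) (leq_addr M N)) /=.
have : 0 <= \sum_(0 <= k < N) c k by rewrite sumr_ge0.
lra.
Qed.

(** Along a sequence of times at which [F (h t)] approaches the minimum, the
    bounded iterates cluster at a minimizer [p]; as the distance to [p] is
    almost nonincreasing, small values of it persist. *)
Lemma quasi_fejer_cvg : exists2 p, argmin F p &
  forall e, 0 < e -> exists N, forall t, (N <= t)%N -> r p t < e.
Proof.
have [v vmin] := F_argmin.
have /choice[tau tauP] k :
    exists t, (k <= t)%N /\ F (h t) - F v < k.+1%:R^-1.
  have k0 : 0 < k.+1%:R^-1 :> R by rewrite invr_gt0.
  by have [t kt Ft] := frequently_near_min k vmin k0; exists t.
have [K cK] := c_sum.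
(* [s ^+ 2 <= r] implies [`|s| <= r + 1] *)
pose M := r v 0%N + K + 1.
have bnd t k : h t 0 k \in `[v 0 k - M, v 0 k + M].
  have rt : r v t + 1 <= M.
    rewrite /M lerD2r (le_trans (r_le vmin (leq0n t)))// lerD2l.
    by rewrite big_mkord.
  have := sqr_entry_le_dotv (h t - v) k; rewrite !mxE -/(r v t) => hk.
  have r0 : 0 <= r v t by exact: dotv_ge0.
  by rewrite in_itv/=; apply/andP; split; nra.
pose u k := h (tau k).
have cpt : compact [set w : 'rV[R]_d | forall k : 'I_d,
    `[v 0 k - M, v 0 k + M]%classic (w ord0 k)].
  apply: (@rV_compact R^o d (fun k => `[v 0 k - M, v 0 k + M]%classic)) => k.
  exact: segment_compact.
have [p [_ pcl]] : [set w : 'rV[R]_d | forall k : 'I_d,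
    `[v 0 k - M, v 0 k + M]%classic (w ord0 k)] `&` cluster (u @ \oo) !=set0.
  by apply: cpt; exists 0%N => // t _ k; exact: bnd.
have near_p e N : 0 < e ->
    exists2 k, (N <= k)%N & forall j, `|p 0 j - u k 0 j| < e.
  move=> e0.
  have A : (u @ \oo) (u @` [set k | (N <= k)%N]).
    by exists N => // k Nk; exists k.
  have [_ [[k Nk <-] /(mx_ballE _ _ e0) Hk]] := pcl _ _ A (nbhsx_ballx p e e0).
  by exists k.
have pmin : argmin F p.
  move=> w; apply: le_trans (vmin w); apply/ler_addgt0Pr => e e0.
  have [g gp] := F_subgrad p.
  pose S := \sum_j `|g 0 j|.
  have S0 : 0 <= S by rewrite sumr_ge0.
  have S1 : 0 < S + 1 by rewrite ltr_wpDl.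
  have e2 : 0 < e / 2 by rewrite divr_gt0.
  have [N HN] : exists N : nat, N.+1%:R^-1 < e / 2.
    exists (Num.trunc (e / 2)^-1).
    by rewrite invf_plt ?posrE// truncnS_gt.
  have [k Nk pk] := near_p (e / 2 / (S + 1)) N (divr_gt0 e2 S1).
  have [_ Fk] := tauP k.
  have gk : - (e / 2) <= dotv g (u k - p).
    rewrite lerNl -dotvNr opprB.
    apply: (@le_trans _ _ (S * (e / 2 / (S + 1)))).
      rewrite /S mulr_suml; apply: ler_sum => j _; rewrite !mxE.
      by rewrite (le_trans (ler_norm _))// normrM ler_wpM2l// ltW.
    by rewrite mulrA ler_pdivrMr// mulrC ler_wpM2l ?ltW// ltrDl.
  have kN : k.+1%:R^-1 <= N.+1%:R^-1 :> R.
    by rewrite lef_pV2 ?posrE ?ltr0n// ler_nat.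
  have Fk2 : F (u k) - F v < e / 2 by apply: lt_trans Fk _; exact: le_lt_trans HN.
  have := gp (u k); lra.
exists p => // e e0.
have e2 : 0 < e / 2 by rewrite divr_gt0.
have [N HN] := bounded_sums_tail c_ge0 c_sum e2.
have d0 : 0 < (d%:R + 1 : R) by rewrite ltr_wpDl.
(* [e' <= 1] gives [e' ^+ 2 <= e'], so that the [d] squared coordinates add up
   to at most [e / 2] *)
pose e' := Num.min 1 (e / 2 / (d%:R + 1)).
have e'0 : 0 < e' by rewrite lt_min ltr01 !divr_gt0.
have [k Nk pk] := near_p e' N e'0.
have [ktau _] := tauP k.
exists (tau k) => t kt.
apply: (le_lt_trans (r_le pmin kt)).
have : r p (tau k) <= e / 2.
  apply: (@le_trans _ _ (\sum_(j < d) e')).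
    apply: ler_sum => j _; rewrite -/(u k) !mxE -expr2.
    have := pk j; rewrite distrC => /ltW pkj.
    have e1 : e' <= 1 by rewrite ge_min lexx.
    rewrite -real_normK ?num_real// expr2 -[leRHS]mulr1.
    by rewrite ler_pM// (le_trans pkj).
  rewrite sumr_const card_ord -[e' *+ d]mulr_natr.
  apply: (@le_trans _ _ (e / 2 / (d%:R + 1) * d%:R)).
    by rewrite ler_wpM2r// ge_min lexx orbT.
  by rewrite [leLHS]mulrAC ler_pdivrMr// ler_wpM2l ?ltW// ltrDl.
have := HN (tau k) t (leq_trans Nk ktau); lra.
Qed.

End Fejer.

(** * Column-stochastic weights and push-sum *)

Section Series.
Variable R : realType.
Implicit Types u : nat -> R.

Lemma sum_shift1_EFin u N :
  (\sum_(1 <= t < N.+1) (u t)%:E)%E = (\sum_(t < N) u t.+1)%:E.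
Proof. by rewrite sumEFin big_add1 /= big_mkord. Qed.

Lemma bounded_sums_of_series_lty u : (forall t, 0 <= u t) ->
  (\sum_(1 <= t <oo) (u t)%:E < +oo)%E -> bounded_sums (fun t => u t.+1).
Proof.
move=> u0 uoo.
have u0' t : (1 <= t)%N -> xpredT t -> (0 <= (u t)%:E)%E by rewrite lee_fin.
exists (fine (\sum_(1 <= t <oo) (u t)%:E)%E) => N.
rewrite -lee_fin fineK; last first.
  by rewrite ge0_fin_numE// nneseries_ge0.
by rewrite -sum_shift1_EFin; exact: nneseries_lim_ge.
Qed.

Lemma unbounded_sums_of_series_eqy u : (forall t, (1 <= t)%N -> 0 <= u t) ->
  (\sum_(1 <= t <oo) (u t)%:E = +oo)%E -> ~ bounded_sums (fun t => u t.+1).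
Proof.
move=> u0 uoo [K uK].
suff : (+oo <= K%:E)%E by rewrite leye_eq.
have u0' t : (1 <= t)%N -> xpredT t -> (0 <= (u t)%:E)%E.
  by move=> t1 _; rewrite lee_fin u0.
rewrite -uoo; apply: lime_le; first exact: is_cvg_nneseries.
exists 1%N => // -[//|N] _ /=.
by rewrite sum_shift1_EFin lee_fin.
Qed.

End Series.

Section Weights.
Variables (R : realType) (n : nat) (E : nat -> rel 'I_n).
Implicit Types (i j : 'I_n) (t : nat).

(** Share of the mass of [j] sent to [i], that is, the coefficient of [j] in
    the update of [i]. *)
Definition weight t i j : R :=
  if link E t j i then (out_degree (E t) j)%:R^-1 else 0.

Lemma sum_in_nbrs t i (c : 'I_n -> R) :
  \sum_(j in in_nbrs (E t) i) c j / (out_degree (E t) j)%:R =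
  \sum_j weight t i j * c j.
Proof.
rewrite big_mkcond; apply: eq_bigr => j _.
by rewrite in_nbrsE /weight; case: ifP => _; rewrite ?mul0r// mulrC.
Qed.

Lemma out_degree_gt0 t j : (0 < out_degree (E t) j)%N.
Proof.
by rewrite card_gt0; apply/set0Pn; exists j; rewrite out_nbrsE /link eqxx.
Qed.

Lemma weight_ge0 t i j : 0 <= weight t i j.
Proof. by rewrite /weight; case: ifP => // _; rewrite invr_ge0. Qed.

Lemma weight_link t i j : link E t j i -> n%:R^-1 <= weight t i j.
Proof.
move=> ji; rewrite /weight ji lef_pV2 ?posrE ?ltr0n ?out_degree_gt0//.
  by rewrite ler_nat -[leqRHS]card_ord max_card.
exact: leq_ltn_trans (ltn_ord i).
Qed.

Lemma weight_col_sum t j : \sum_i weight t i j = 1.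
Proof.
rewrite -big_mkcond /= sumr_const -[LHS]mulr_natr.
rewrite (_ : #|_| = out_degree (E t) j); last first.
  by apply: eq_card => i; rewrite out_nbrsE.
by rewrite mulVf// pnatr_eq0 -lt0n out_degree_gt0.
Qed.

End Weights.

Section PushSum.
Variables (R : realType) (n : nat) (E : nat -> rel 'I_n).
Variable y : nat -> 'I_n -> R.
Hypothesis y0 : forall i, y 0%N i = 1.
Hypothesis yS : forall t i, y t.+1 i = \sum_j weight R E t i j * y t j.
Implicit Types (i j : 'I_n) (t : nat).

Lemma push_sum_ge0 t i : 0 <= y t i.
Proof.
elim: t i => [|t IH] i; first by rewrite y0.
by rewrite yS sumr_ge0// => j _; rewrite mulr_ge0// weight_ge0.
Qed.

Lemma push_sum_total t : \sum_i y t i = n%:R.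
Proof.
elim: t => [|t IH].
  by under eq_bigr do rewrite y0; rewrite sumr_const card_ord.
under eq_bigr do rewrite yS.
rewrite exchange_big -{}IH; apply: eq_bigr => j _ /=.
by rewrite -mulr_suml weight_col_sum mul1r.
Qed.

Lemma push_sum_le t i : y t i <= n%:R.
Proof.
rewrite -(push_sum_total t) (bigD1 i)//= lerDl sumr_ge0// => j _.
exact: push_sum_ge0.
Qed.

Variable T : nat.
Hypothesis full : forall t j, reach E t j T = [set: 'I_n]%SET.

Lemma push_sum_link t l i : link E t l i -> n%:R^-1 * y t l <= y t.+1 i.
Proof.
move=> li; rewrite yS (bigD1 l)//= -[leLHS]addr0 lerD//.
  by rewrite ler_wpM2r ?push_sum_ge0// weight_link.
by rewrite sumr_ge0// => j _; rewrite mulr_ge0 ?weight_ge0 ?push_sum_ge0.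
Qed.

(** During the first [T] steps each node retains part of its own initial mass;
    later, it receives a fraction of the mass of a node that had at least the average
    value [1] exactly [T] steps before. *)
Lemma push_sum_lower_bound t i : n%:R^-1 ^+ T <= y t i.
Proof.
have n0 : (0 < n)%N by exact: leq_ltn_trans (ltn_ord i).
have b0 : 0 <= n%:R^-1 :> R by rewrite invr_ge0.
have b1 : n%:R^-1 <= 1 :> R by rewrite invf_le1 ?ler1n ?ltr0n.
have [tT|Tt] := ltnP t T.
  have := @reach_lower_bound n E R _ y 0 i b0
    (fun s l k _ => @push_sum_link s l k) t i.
  rewrite y0 mulr1 add0n => H; apply: le_trans (H _); last first.
    apply: (fintype.subsetP (@reach_subset _ E 0 i 0 _ (leq0n _))).
    by rewrite inE.
  by rewrite ler_wiXn2l// ltnW.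
have [j yj] : exists j, 1 <= y (t - T)%N j.
  apply: contrapT => H; have : \sum_j y (t - T)%N j < \sum_(j < n) 1.
    apply: ltr_sum; first by apply/hasP; exists i => //; rewrite mem_index_enum.
    by move=> j _; rewrite ltNge; apply/negP => ?; apply: H; exists j.
  by rewrite push_sum_total sumr_const card_ord ltxx.
have := @reach_lower_bound n E R _ y (t - T)%N j b0
    (fun s l k _ => @push_sum_link s l k) T i.
rewrite full inE subnK// => /(_ isT); apply: le_trans.
by rewrite ler_peMr// exprn_ge0.
Qed.

(** The averaging matrix satisfied by the ratios to [y]. *)
Definition ratio_weight t i j : R := weight R E t i j * y t j / y t.+1 i.

Lemma push_sum_gt0 t i : 0 < y t i.
Proof.
apply: lt_le_trans (push_sum_lower_bound t i).
by rewrite exprn_gt0// invr_gt0 ltr0n; exact: leq_ltn_trans (ltn_ord i).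
Qed.

Lemma ratio_weight_ge0 t i j : 0 <= ratio_weight t i j.
Proof. by rewrite divr_ge0 ?mulr_ge0 ?weight_ge0 ?push_sum_ge0. Qed.

Lemma ratio_weight_sum t i : \sum_j ratio_weight t i j = 1.
Proof. by rewrite -mulr_suml -yS mulfV// gt_eqF// push_sum_gt0. Qed.

(** The factors of the bound come from the weight, from the lower bound on
    [y t j] and from the upper bound on [y t.+1 i]. *)
Lemma ratio_weight_link t i j :
  link E t j i -> n%:R^-1 * n%:R^-1 ^+ T / n%:R <= ratio_weight t i j.
Proof.
move=> ji; have b0 : 0 <= n%:R^-1 :> R by rewrite invr_ge0.
rewrite ler_pM ?mulr_ge0 ?exprn_ge0//.
  by rewrite ler_pM ?exprn_ge0// ?weight_link// push_sum_lower_bound.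
rewrite lef_pV2 ?posrE ?push_sum_gt0 ?push_sum_le// ltr0n.
exact: leq_ltn_trans (ltn_ord i).
Qed.

Lemma sum_ratio_weight t i (c : 'I_n -> R) :
  \sum_j ratio_weight t i j * (c j / y t j) =
  (\sum_j weight R E t i j * c j) / y t.+1 i.
Proof.
rewrite mulr_suml; apply: eq_bigr => j _; rewrite /ratio_weight.
have yj := lt0r_neq0 (push_sum_gt0 t j).
have yi := lt0r_neq0 (push_sum_gt0 t.+1 i).
by field; rewrite yi yj.
Qed.

End PushSum.

(** * Convergence of subgradient-push *)

Section SubgradientPush.
Variables (R : realType) (n d : nat).
Variables (f : 'I_n -> 'rV[R]_d -> R) (E : nat -> rel 'I_n) (alpha : nat -> R).
Variables (x w z g : nat -> 'I_n -> 'rV[R]_d) (y : nat -> 'I_n -> R).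
Hypothesis push : subgradient_push f E alpha x w z g y.
Hypothesis n_gt0 : (0 < n)%N.
Hypothesis alpha_ge0 : forall t, 0 <= alpha t.+1.
Variable L : R.
Hypothesis f_subgrad : forall i u, exists v, subgradient (f i) u v.
Hypothesis f_subgrad_bound : forall i u v,
  subgradient (f i) u v -> dotv v v <= L ^+ 2.
Implicit Types (i j : 'I_n) (t : nat) (k : 'I_d).

(** The mean of the [x t i]; as the weights are column stochastic, only the
    subgradients move it. *)
Definition mean t : 'rV[R]_d := n%:R^-1 *: \sum_i x t i.

Lemma push_wE t i k : w t.+1 i 0 k = \sum_j weight R E t i j * x t j 0 k.
Proof.
rewrite (push_w push) summxE -sum_in_nbrs; apply: eq_bigr => j _.
by rewrite mxE mulrC.
Qed.

Lemma push_yE t i : y t.+1 i = \sum_j weight R E t i j * y t j.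
Proof. by rewrite (push_y push) sum_in_nbrs. Qed.

Lemma meanS t : mean t.+1 = mean t - (alpha t.+1 / n%:R) *: \sum_i g t.+1 i.
Proof.
rewrite /mean mulrC -scalerA -scalerBr; congr (_ *: _).
under eq_bigr do rewrite (push_x push).
rewrite big_split sumrN -scaler_sumr; congr (_ + _).
apply/rowP => k; rewrite !summxE.
under eq_bigr do rewrite push_wE.
rewrite exchange_big; apply: eq_bigr => j _ /=.
by rewrite -mulr_suml weight_col_sum mul1r.
Qed.

Lemma total_subgradient u :
  exists v, subgradient (fun u => \sum_i f i u) u v.
Proof.
have /choice[v vP] i := f_subgrad i u.
exists (\sum_i v i) => u'; rewrite dotv_suml -big_split.
by apply: ler_sum => i _; exact: vP.
Qed.

(** One step of the method moves the mean along approximate subgradients of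
    the sum at the mean; the error is quadratic in the step size and in the
    distances of the nodes to the mean. *)
Lemma mean_descent (Q : nat -> R) v t :
  (forall i, dotv (z t.+1 i - mean t) (z t.+1 i - mean t) <= Q t) ->
  dotv (mean t.+1 - v) (mean t.+1 - v) <= dotv (mean t - v) (mean t - v) -
    (2 / n%:R * alpha t.+1) * (\sum_i f i (mean t) - \sum_i f i v) +
    (3 * L ^+ 2 * alpha t.+1 ^+ 2 + 2 * Q t).
Proof.
move=> zQ; set h := mean t; set al := alpha t.+1.
have al0 : 0 <= al by exact: alpha_ge0.
have n0 : 0 < n%:R :> R by rewrite ltr0n.
pose G := \sum_i g t.+1 i.
have gL i : dotv (g t.+1 i) (g t.+1 i) <= L ^+ 2.
  exact: f_subgrad_bound (push_g push t i).
have GL : dotv G G <= n%:R ^+ 2 * L ^+ 2.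
  rewrite dotv_suml; apply: (@le_trans _ _ (\sum_(i < n) \sum_(j < n) L ^+ 2)).
    apply: ler_sum => i _; rewrite dotvC dotv_suml; apply: ler_sum => j _.
    have := dotv_young 1 (g t.+1 j) (g t.+1 i).
    by have := gL i; have := gL j; lra.
  by rewrite !sumr_const card_ord -mulrnA -[leLHS]mulr_natl natrM expr2.
have step i : - 2 * al * dotv (g t.+1 i) (h - v) <=
    - 2 * al * (f i h - f i v) + (2 * L ^+ 2 * al ^+ 2 + 2 * Q t).
  (* [g t.+1 i] compares [f i] at [z t.+1 i] and [v], a subgradient [s] at [h]
     compares it at [h] and [z t.+1 i]; both remainders are absorbed in
     squares *)
  have [s sP] := f_subgrad i h.
  have sL := f_subgrad_bound sP.
  have gv := push_g push t i v.
  have sz := sP (z t.+1 i).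
  have Qi := zQ i.
  have Y1 := dotv_young al (g t.+1 i) (z t.+1 i - h).
  have Y2 := dotv_young (- al) s (z t.+1 i - h).
  have M1 : al ^+ 2 * dotv (g t.+1 i) (g t.+1 i) <= al ^+ 2 * L ^+ 2.
    by rewrite ler_wpM2l ?sqr_ge0.
  have M2 : al ^+ 2 * dotv s s <= al ^+ 2 * L ^+ 2.
    by rewrite ler_wpM2l ?sqr_ge0.
  rewrite sqrrN in Y2.
  have D : al * (f i h - f i v + dotv s (z t.+1 i - h)) <=
           al * dotv (g t.+1 i) (z t.+1 i - v).
    rewrite ler_wpM2l//; move: gv sz; rewrite !dotvBr; lra.
  move: D Y1 Y2 Qi; rewrite !dotvBr; lra.
have sum_step : - 2 * al * dotv G (h - v) <= - 2 * al *
   (\sum_i f i h - \sum_i f i v) + n%:R * (2 * L ^+ 2 * al ^+ 2 + 2 * Q t).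
  set c := 2 * L ^+ 2 * al ^+ 2 + 2 * Q t.
  have -> : n%:R * c = \sum_(i < n) c by rewrite sumr_const card_ord mulr_natl.
  rewrite dotv_suml -sumrB !mulr_sumr -big_split.
  by apply: ler_sum => i _; exact: step.
rewrite meanS -/h -/al -/G.
have -> : dotv (h - (al / n%:R) *: G - v) (h - (al / n%:R) *: G - v) =
   dotv (h - v) (h - v) + (- 2 * al * dotv G (h - v)) / n%:R +
   al ^+ 2 * (dotv G G / n%:R ^+ 2).
  rewrite [h - _ - v]addrAC [LHS]dotvBB dotvZr dotvZl dotvZr (dotvC (h - v) G).
  by field; rewrite gt_eqF.
have H1 : - 2 * al * dotv G (h - v) / n%:R <= (- 2 * al *
   (\sum_i f i h - \sum_i f i v) + n%:R * (2 * L ^+ 2 * al ^+ 2 + 2 * Q t)) / n%:R.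
  by rewrite ler_wpM2r// invr_ge0 ltW.
have H2 : al ^+ 2 * (dotv G G / n%:R ^+ 2) <= al ^+ 2 * L ^+ 2.
  by rewrite ler_wpM2l ?sqr_ge0// ler_pdivrMr ?exprn_gt0// mulrC.
rewrite mulrDl [n%:R * _]mulrC mulfK ?gt_eqF// in H1.
have H3 : - 2 * al * (\sum_i f i h - \sum_i f i v) / n%:R =
  - (2 / n%:R * al * (\sum_i f i h - \sum_i f i v)) by field; rewrite gt_eqF.
rewrite H3 in H1; lra.
Qed.

Variable T : nat.
Hypothesis full : forall t j, reach E t j T = [set: 'I_n]%SET.
Hypothesis L_ge0 : 0 <= L.
Hypothesis alpha_noninc : forall s t, (s <= t)%N -> alpha t.+1 <= alpha s.+1.
Hypothesis alpha_sqr : bounded_sums (fun t => alpha t.+1 ^+ 2).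

(* the coordinate [k] of the ratio to which the averaging applies *)
Let ratio k t i := x t i 0 k / y t i.

(** Sum over the coordinates of the squared spread of the ratios. *)
Definition disagreement t : R := \sum_k spread (ratio k t) ^+ 2.

Lemma disagreement_ge0 t : 0 <= disagreement t.
Proof. by apply: sumr_ge0 => k _; exact: sqr_ge0. Qed.

(** Both [z t.+1 i] and [mean t] are weighted averages of the ratios
    [x t j / y t j]. *)
Lemma dist_mean_le_disagreement t i :
  dotv (z t.+1 i - mean t) (z t.+1 i - mean t) <= disagreement t.
Proof.
have y0 := push_y0 push; have yS := push_yE.
have n0 : 0 < n%:R :> R by rewrite ltr0n.
apply: ler_sum => k _; rewrite -expr2.
pose p j := ratio_weight E y t i j.
pose q j := y t j / n%:R.
have -> : (z t.+1 i - mean t) 0 k =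
   \sum_j p j * ratio k t j - \sum_j q j * ratio k t j.
  have zE : z t.+1 i 0 k = (y t.+1 i)^-1 * w t.+1 i 0 k.
    by rewrite (push_z push) mxE.
  have hE : mean t 0 k = n%:R^-1 * \sum_j x t j 0 k by rewrite mxE summxE.
  rewrite mxE [X in _ + X]mxE zE hE push_wE.
  rewrite (sum_ratio_weight y0 yS full) mulrC; congr (_ - _).
  rewrite mulr_sumr; apply: eq_bigr => j _; rewrite /q /ratio.
  have := gt_eqF (push_sum_gt0 y0 yS full t j) => yN0.
  by field; rewrite yN0 gt_eqF.
have p0 j : 0 <= p j by exact: ratio_weight_ge0.
have p1 : \sum_j p j = 1 by exact: ratio_weight_sum full _ _.
have q0 j : 0 <= q j by rewrite divr_ge0// (push_sum_ge0 y0 yS).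
have q1 : \sum_j q j = 1.
  by rewrite -mulr_suml (push_sum_total y0 yS) mulfV// gt_eqF.
have pq := dist_averages_le_spread (ratio k t) p0 p1 q0 q1.
have qp := dist_averages_le_spread (ratio k t) q0 q1 p0 p1.
rewrite -real_normK ?num_real// ler_sqr ?nnegrE ?spread_ge0//.
by rewrite ler_norml pq andbT; lra.
Qed.

Lemma disagreement_bounded_sums : bounded_sums disagreement.
Proof.
have y0 := push_y0 push; have yS := push_yE.
have n0 : 0 < n%:R :> R by rewrite ltr0n.
apply: bounded_sums_sum => k.
pose dl : R := n%:R^-1 ^+ T.
have nV0 : 0 < n%:R^-1 :> R by rewrite invr_gt0.
have nV1 : n%:R^-1 <= 1 :> R by rewrite invf_le1 ?ler1n.
have dl0 : 0 < dl by rewrite exprn_gt0.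
have b0 : 0 < n%:R^-1 * dl / n%:R by rewrite !mulr_gt0.
have b1 : n%:R^-1 * dl / n%:R <= 1.
  have dl1 : dl <= 1 by rewrite exprn_ile1// ltW.
  by rewrite mulr_ile1 ?mulr_ile1 ?mulr_ge0 ?(ltW nV0) ?(ltW dl0).
apply: (@spread_sqr_bounded_sums _ _ E (ratio_weight E y) _ n_gt0 b0 b1
  _ _ _ _ (fun t => alpha t.+1) (L / dl) T) => //.
- exact: ratio_weight_ge0.
- exact: ratio_weight_sum full.
- exact: ratio_weight_link full.
- by rewrite divr_ge0// ltW.
move=> t i; rewrite /ratio (sum_ratio_weight y0 yS full).
rewrite -push_wE (push_x push) !mxE -mulrBl addrAC subrr add0r.
have gL : `|g t.+1 i 0 k| <= L.
  rewrite -ler_sqr ?nnegrE// real_normK ?num_real//.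
  apply: le_trans (sqr_entry_le_dotv _ _) _.
  exact: f_subgrad_bound (push_g push t i).
have yp := push_sum_gt0 y0 yS full t.+1 i.
rewrite normrM normrN normrM (ger0_norm (alpha_ge0 t)) normfV (gtr0_norm yp).
rewrite -[leLHS]mulrA [leRHS]mulrC ler_wpM2l// ler_pM//.
  by rewrite invr_ge0 ltW.
by rewrite lef_pV2 ?posrE// (push_sum_lower_bound y0 yS full).
Qed.

Hypothesis alpha_sum : ~ bounded_sums (fun t => alpha t.+1).
Hypothesis argmin_nonempty : argmin (fun u => \sum_i f i u) !=set0.

Lemma subgradient_push_cvg : exists2 p, argmin (fun u => \sum_i f i u) p &
  forall i, z t i @[t --> \oo] --> p.
Proof.
have n0 : 0 < n%:R :> R by rewrite ltr0n.
have [p pmin hp] : exists2 p, argmin (fun u => \sum_i f i u) p &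
   forall e, 0 < e -> exists N, forall t, (N <= t)%N ->
   dotv (mean t - p) (mean t - p) < e.
  apply: (@quasi_fejer_cvg R d _ mean (fun t => 2 / n%:R * alpha t.+1)
     (fun t => 3 * L ^+ 2 * alpha t.+1 ^+ 2 + 2 * disagreement t)) => //.
  - exact: total_subgradient.
  - by move=> t; rewrite mulr_ge0// divr_ge0// ltW.
  - move=> [K aK]; apply: alpha_sum; exists (K * (n%:R / 2)) => N.
    rewrite -ler_pdivrMr ?divr_gt0// invf_div mulrC mulr_sumr.
    exact: aK.
  - move=> t; rewrite addr_ge0 ?mulr_ge0 ?sqr_ge0//.
    exact: disagreement_ge0.
  - apply: bounded_sumsD; apply: bounded_sumsZ => //.
      by rewrite mulr_ge0// sqr_ge0.
    exact: disagreement_bounded_sums.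
  - move=> v t _; apply: mean_descent => i.
    exact: dist_mean_le_disagreement.
exists p => // i; apply/cvg_ballP => e e0.
have e2 : 0 < (e / 2) ^+ 2 by rewrite exprn_gt0// divr_gt0.
have [N1 HN1] := hp _ e2.
have [N2 HN2] := bounded_sums_tail disagreement_ge0 disagreement_bounded_sums e2.
exists (maxn N1 N2).+1 => // -[//|t] /= Nt.
have N1t : (N1 <= t)%N by rewrite (leq_trans (leq_maxl _ _) Nt).
have N2t : (N2 <= t)%N by rewrite (leq_trans (leq_maxr _ _) Nt).
apply/mx_ballE => // k.
have small (u v : 'rV[R]_d) :
    dotv (u - v) (u - v) < (e / 2) ^+ 2 -> `|u 0 k - v 0 k| < e / 2.
  move=> uve; rewrite -ltr_sqr ?nnegrE ?divr_ge0 ?(ltW e0)//.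
  rewrite real_normK ?num_real//; apply: le_lt_trans uve.
  by have := sqr_entry_le_dotv (u - v) k; rewrite !mxE.
have hk := small _ _ (HN1 _ N1t).
have := HN2 t t.+1 N2t; rewrite big_nat1.
move=> /(le_lt_trans (dist_mean_le_disagreement t i)) /small zk.
rewrite distrC -(subrKA (mean t 0 k)).
by rewrite (le_lt_trans (ler_normD _ _))// [ltRHS]splitr ltrD.
Qed.

End SubgradientPush.

Theorem theorem1 (R : realType) (n d : nat) (n_ge1 : (1 <= n)%N)
  (d_ge1 : (1 <= d)%N)
  (f : 'I_n -> 'rV[R]_d -> R)
  (E : nat -> rel 'I_n)
  (E_usc : uniformly_strongly_connected E)
  (f_convex : forall i, @convex_function R 'rV[R]_d [set: 'rV[R]_d] (f i))
  (Zstar_nonempty : argmin (fun u => \sum_(i < n) f i u) !=set0)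
  (f_subgrad_bounded : forall i, exists L : R,
     forall u g : 'rV[R]_d, subgradient (f i) u g -> norm2 g <= L)
  (alpha : nat -> R)
  (alpha_gt0 : forall t : nat, (1 <= t)%N -> 0 < alpha t)
  (alpha_sum : (\sum_(1 <= t <oo) (alpha t)%:E = +oo)%E)
  (alpha_sqr_sum : (\sum_(1 <= t <oo) ((alpha t ^+ 2)%R)%:E < +oo)%E)
  (alpha_noninc : forall s t : nat, (1 <= s)%N -> (s < t)%N ->
     alpha t <= alpha s)
  (x w z g : nat -> 'I_n -> 'rV[R]_d) (y : nat -> 'I_n -> R)
  (push : subgradient_push f E alpha x w z g y) :
  exists2 zstar : 'rV[R]_d, argmin (fun u => \sum_(i < n) f i u) zstar &
    forall i : 'I_n, z t i @[t --> \oo] --> zstar.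
Proof.
have [B B0 sc] := E_usc.
have /choice[L LP] := f_subgrad_bounded.
pose M := \sum_i `|L i|.
have M0 : 0 <= M by rewrite sumr_ge0.
apply: (@subgradient_push_cvg R n d f E alpha x w z g y push n_ge1 _ M _ _
  (n.+1 * B)) => //.
- by move=> t; rewrite ltW// alpha_gt0.
- by move=> i u; exact: subgradient_exists.
- move=> i u v /LP vL; apply: dotv_le_of_norm2.
  rewrite (le_trans vL)// (le_trans (ler_norm _))//.
  by rewrite /M (bigD1 i)//= lerDl sumr_ge0.
- by move=> t j; exact: reach_full.
- by move=> s t; rewrite leq_eqVlt => /predU1P[->//|st]; exact: alpha_noninc.
- by apply: (bounded_sums_of_series_lty _ alpha_sqr_sum) => t; rewrite sqr_ge0.
- by apply: unbounded_sums_of_series_eqy => // t /alpha_gt0/ltW.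
Qed.
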